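(* Let $n\ge2$ and $\mathcal{X}:=\{1,\ldots,n\}$. Let $q_+,q_-\colon\mathcal{X}\to[0,\infty)$ be functions that are positive everywhere except that $q_-(1)=q_+(n)=0$, and assume $$\forall x\in\{1,\ldots,n-1\},\qquad q_+(x+1)\le q_+(x)\quad\text{and}\quad q_-(x+1)\ge q_-(x).$$ Let $(P_t)_{t\ge0}$ be the semi-group generated by the birth and death generator $$Lf(x):=q_+(x)\left(f(x+1)-f(x)\right)+q_-(x)\left(f(x-1)-f(x)\right),$$ and let $\pi$ be its unique invariant law. Then for every initial law $\mu\in\mathcal{P}(\mathcal{X})$ and every time $t\ge0$, $$H(\mu P_t\,|\,\pi)\le \mathrm{m}(t)\,H(\mu\,|\,\pi),\qquad\text{where}\qquad \mathrm{m}(t):=\max_{1\le x<n}\left(\mathbb{E}_{x+1}[X_t]-\mathbb{E}_x[X_t]\right).$$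
   Context: $(X_t)_{t\ge0}$ is the continuous-time Markov chain on $\mathcal{X}$ with generator $L$, and $\mathbb{E}_x[\cdot]$ denotes expectation when $X_0=x$; $P_t=e^{tL}$. The invariant law is explicitly $\pi(x)=\frac1C\prod_{k=2}^x\frac{q_+(k-1)}{q_-(k)}$ with $C$ a normalizing constant. $\mathcal{P}(\mathcal{X})$ is the set of probability measures on $\mathcal{X}$, and $H(\mu\,|\,\pi):=\sum_x\mu(x)\log(\mu(x)/\pi(x))$ is the relative entropy (with $0\log0=0$). *)

(* Defs.v *)
From HB Require Import structures.
From mathcomp Require Import all_boot all_order all_algebra.
From mathcomp Require Import all_classical all_reals all_analysis.

Set Implicit Arguments.
Unset Strict Implicit.
Unset Printing Implicit Defensive.

Import Order.TTheory GRing.Theory Num.Theory.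
Import numFieldNormedType.Exports.

Local Open Scope classical_set_scope.
Local Open Scope ring_scope.

(* The state space {1, ..., n} is encoded by 'I_n: the ordinal x stands for   *)
(* the state x + 1, whose numerical value is [state_val x].                   *)
Definition state_val (R : realType) (n : nat) (x : 'I_n) : R := x.+1%:R.

(* At the boundary these return x itself; this only ever matters multiplied   *)
(* by the zero rates q_+(n) and q_-(1).                                       *)
Definition state_up (n : nat) (x : 'I_n) : 'I_n := insubd x x.+1.
Definition state_down (n : nat) (x : 'I_n) : 'I_n := insubd x x.-1.

Definition bd_rates (R : realType) (n : nat) (qp qm : 'I_n -> R) : Prop :=
  [/\ forall x : 'I_n, (x.+1 < n)%N -> 0 < qp x,
      forall x : 'I_n, x.+1 = n -> qp x = 0,
      forall x : 'I_n, (0 < x)%N -> 0 < qm x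
    & forall x : 'I_n, x = 0%N :> nat -> qm x = 0].

Definition bd_gen (R : realType) (n : nat) (qp qm : 'I_n -> R)
    (f : 'I_n -> R) (x : 'I_n) : R :=
  qp x * (f (state_up x) - f x) + qm x * (f (state_down x) - f x).

(* The matrix L(x, y) = (L 1_y)(x) of the operator [bd_gen]. *)
Definition bd_mx (R : realType) (n : nat) (qp qm : 'I_n -> R) : 'M[R]_n :=
  \matrix_(x, y) bd_gen qp qm (fun z => (z == y)%:R) x.

(* e^{tA}, as the entrywise sum of the series of the t^k A^k / k!. *)
Definition semigroup (R : realType) (n : nat) (A : 'M[R]_n) (t : R) : 'M[R]_n :=
  \matrix_(x, y) limn (series (fun k => t ^+ k / k`!%:R * (A ^+ k) x y)).

(* Probability measures on the state space are row vectors, so that the       *)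
(* action of a transition matrix P on a law mu is the product mu *m P.        *)
Definition is_law (R : realType) (n : nat) (mu : 'rV[R]_n) : Prop :=
  (forall x, 0 <= mu 0 x) /\ \sum_x mu 0 x = 1.

Definition invariant_law (R : realType) (n : nat) (A : 'M[R]_n)
    (pi : 'rV[R]_n) : Prop :=
  is_law pi /\ forall t, 0 <= t -> pi *m semigroup A t = pi.

(* The convention 0 log 0 = 0 holds thanks to the factor mu(x).  This is the  *)
(* usual relative entropy as soon as pi charges every state.                  *)
Definition rel_entropy (R : realType) (n : nat) (mu pi : 'rV[R]_n) : R :=
  \sum_x mu 0 x * ln (mu 0 x / pi 0 x).

(* X, observed at nonnegative times, is a Markov chain with generator A, and  *)
(* [Pr x] is its law when started at x: the finite-dimensional distributions  *)
(* are P_x(X_{s_0} = y_0, ..., X_{s_k} = y_k) =                               *)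
(*     \prod_(i < k) P_{s_{i+1} - s_i}(y_i, y_{i+1})                          *)
(* for 0 = s_0 <= s_1 <= ... and y_0 = x, where P_t = e^{tA}.                 *)
Definition markov_chain (R : realType) (n : nat) (A : 'M[R]_n)
    (d : measure_display) (T : measurableType d) (Pr : 'I_n -> probability T R)
    (X : R -> T -> 'I_n) : Prop :=
  (forall t y, 0 <= t -> measurable (X t @^-1` [set y])) /\
  (forall (k : nat) (s : nat -> R) (y : nat -> 'I_n),
     s 0%N = 0 -> (forall i, s i <= s i.+1) ->
     Pr (y 0%N) (\bigcap_(i in `I_k.+1) (X (s i) @^-1` [set y i])) =
     (\prod_(i < k) semigroup A (s i.+1 - s i) (y i) (y i.+1))%:E).

(* The maximum over 1 <= x < n of E_{x+1}[X_t] - E_x[X_t]; the index set is   *)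
(* nonempty when n >= 2, so the default value -oo plays no role.              *)
Definition max_increment (R : realType) (n : nat)
    (d : measure_display) (T : measurableType d) (Pr : 'I_n -> probability T R)
    (X : R -> T -> 'I_n) (t : R) : \bar R :=
  (\big[maxe/-oo]_(x < n | (x.+1 < n)%N)
     ('E_(Pr (state_up x))[(fun w => state_val R (X t w))]
      - 'E_(Pr x)[(fun w => state_val R (X t w))]))%E.

(* Main.v *)
Require Import Defs.
From HB Require Import structures.
From mathcomp Require Import all_boot all_order all_algebra.
From mathcomp Require Import all_classical all_reals all_analysis.
From mathcomp Require Import measurable_realfun.
From mathcomp Require Import zify ring lra.

Set Implicit Arguments.
Unset Strict Implicit.
Unset Printing Implicit Defensive.

Import Order.TTheory GRing.Theory Num.Theory.
Import numFieldNormedType.Exports.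

Local Open Scope classical_set_scope.
Local Open Scope ring_scope.

(* Let g_s be the density of mu P_s with respect to pi; by reversibility      *)
(* g' = L g, and the entropy of g_s has derivative - D(g_s), where            *)
(*   D(g) = sum_x c(x) phi(g(x), g(x + 1)),  c(x) = pi(x) q_+(x),             *)
(*   phi(a, b) = (a - b) (log a - log b).                                     *)
(* Under the monotone coupling, an edge {x, x + 1} moves to x + 1 at rate     *)
(* q_+(x + 1), to x - 1 at rate q_-(x), and collapses at the remaining rate,  *)
(* which is nonnegative by monotonicity of the rates.  The generator G of     *)
(* this killed chain of edges is reversible with respect to c.  As phi is     *)
(* jointly convex, 1-homogeneous and zero on the diagonal,                    *)
(* u_s(x) = phi(g_s(x), g_s(x + 1)) satisfies u' <= G u.  On the other hand   *)
(* w_s(x) = E_{x+1}[X_s] - E_x[X_s] satisfies w' = G w and w_0 = 1, so that   *)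
(* tau |-> <w_{t-tau}, u_{s+tau}>_c is nonincreasing, whence                  *)
(*   D(g_{s+t}) <= <w_t, u_s>_c <= m(t) D(g_s).                               *)
(* Integrating over s >= 0 gives the claim because the entropy of g_s tends   *)
(* to 0.  A law mu without full support is approximated by (1 - e) mu + e pi. *)

(** * Derivatives and the matrix exponential *)

(** The scheme above rests on one dynamics, that of an edge which moves or collapses under the
    monotone coupling. The increments of x |-> E_x[X_s] follow it exactly ([edge_gen_increment]),
    and the edge terms of the dissipation are a subsolution of it ([phi_derive_le_edge_gen]). Since
    its generator is self-adjoint ([edge_gen_reversible]), interpolating between the two evolutions
    gives [dissipation_evolution]: over a time t the dissipation is multiplied by at most m(t).
    [entropy_contraction] passes to the entropy without integrals: s |-> m Ent(g_s) - Ent(g_{s+t})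
    is nonincreasing and tends to 0 by [entropy_exp_decay], so it is nonnegative at s = 0.
    Reversibility comes from [invariant_law_detailed_balance], [rel_entropy_contraction] treats laws
    without full support, and [max_incrementE] expresses m(t) through the semigroup. *)

Lemma is_derive_fun_sum {R : realType} (I : finType) (f : I -> R -> R)
  (df : I -> R) (t : R) :
  (forall i, is_derive t 1 (f i) (df i)) ->
  is_derive t 1 (fun s => \sum_i f i s) (\sum_i df i).
Proof.
move=> fd; have -> : (fun s => \sum_i f i s) = \sum_i f i.
  by apply/funext => s; rewrite fct_sumE.
elim/big_ind2 : _ => // [|] *; [exact: is_derive_cst|exact: is_deriveD].
Qed.

Lemma is_derive_fun_mul {R : realType} (f g : R -> R) (df dg t : R) :
  is_derive t 1 f df -> is_derive t 1 g dg ->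
  is_derive t 1 (fun s => f s * g s) (df * g t + f t * dg).
Proof.
move=> fd gd; apply: (@is_derive_eq _ _ _ (f * g)).
by rewrite /GRing.scale/= addrC mulrC.
Qed.

Lemma is_derive_mull {R : realType} (c : R) (f : R -> R) (df t : R) :
  is_derive t 1 f df -> is_derive t 1 (fun s => c * f s) (c * df).
Proof.
move=> fd; have := is_derive_fun_mul (is_derive_cst c t 1) fd.
by rewrite mul0r add0r.
Qed.

Lemma is_derive_affine_comp {R : realType} (f : R -> R) (a b df t : R) :
  is_derive (a * t + b) 1 f df ->
  is_derive t 1 (fun s => f (a * s + b)) (a * df).
Proof.
move=> fd.
have ad : is_derive t 1 (fun s : R => a * s + b) a.
  have := is_deriveD (is_derive_mull a (is_derive_id t 1))
    (is_derive_cst b t 1).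
  by rewrite mulr1 addr0.
have := @is_derive1_comp R f (fun s => a * s + b) t _ _ fd ad.
by rewrite /GRing.scale/= mulrC.
Qed.

Lemma is_derive_expRM {R : realType} (c t : R) :
  is_derive t 1 (fun s => expR (c * s)) (c * expR (c * t)).
Proof.
have := @is_derive_affine_comp R expR c 0 (expR (c * t)) t.
rewrite addr0 => /(_ (is_derive_expR _)).
by under [X in is_derive _ _ X]funext => s do rewrite addr0.
Qed.

Lemma le_of_derive_le0 {R : realType} (f df : R -> R) (a b : R) : a <= b ->
  (forall s, a <= s <= b -> is_derive s 1 f (df s)) ->
  (forall s, a <= s <= b -> df s <= 0) -> f b <= f a.
Proof.
move=> ab fd df0.
have [||c + e] := @MVT_segment R f df a b ab.
- by move=> x /[!in_itv]/= /andP[ax xb]; apply: fd; rewrite !ltW.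
- apply: derivable_within_continuous => x /[!in_itv]/= xab.
  by have [] := fd _ xab.
rewrite in_itv/= => /df0 c0.
by rewrite -subr_le0 e; apply: mulr_le0_ge0 => //; rewrite subr_ge0.
Qed.

Lemma eq_of_derive_eq0 {R : realType} (f : R -> R) (a b : R) : a <= b ->
  (forall s, a <= s <= b -> is_derive s 1 f 0) -> f b = f a.
Proof.
move=> ab fd; apply/eqP; rewrite eq_le; apply/andP; split.
  exact: (@le_of_derive_le0 _ f (fun=> 0)).
rewrite -lerN2; apply: (@le_of_derive_le0 _ (- f) (fun=> 0) a b ab) => // s hs.
by have := fd _ hs => fds; apply: is_derive_eq; rewrite oppr0.
Qed.

Lemma cvg_series_sum {R : realType} (I : finType) (f : I -> R^nat) :
  (forall i, cvgn (series (f i))) ->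
  series (fun k => \sum_i f i k) @ \oo --> \sum_i limn (series (f i)).
Proof.
move=> cf.
have -> : series (fun k => \sum_i f i k) = fun k => \sum_i series (f i) k.
  by apply/funext => k; rewrite /series/= exchange_big.
apply: cvg_big => [|i _]; last exact: cf.
exact: add_continuous.
Qed.

Lemma lim_series_sum {R : realType} (I : finType) (f : I -> R^nat) :
  (forall i, cvgn (series (f i))) ->
  limn (series (fun k => \sum_i f i k)) = \sum_i limn (series (f i)).
Proof. by move=> cf; apply: cvg_lim => //; exact: cvg_series_sum. Qed.

Section matrix_exponential.
Context {R : realType} {n : nat}.
Implicit Types (A : 'M[R]_n) (t : R).

(** The entries of the exponential are written as power series in t, so that they can be
    differentiated term by term. *)
Let coef A x y : R^nat := fun k => (A ^+ k) x y / k`!%:R.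

Lemma semigroupE A t x y : semigroup A t x y = limn (pseries (coef A x y) t).
Proof.
rewrite mxE /pseries; congr (limn (series _)); apply/funext => k.
by rewrite /coef mulrC mulrA mulrAC.
Qed.

Lemma expmx_bound A : exists2 a, 0 <= a &
  forall k x y, `|(A ^+ k) x y| <= a ^+ k.
Proof.
have [a a0 Aa] : exists2 a, 0 <= a & forall x y, `|A x y| <= a.
  exists (\sum_x \sum_y `|A x y|).
    by apply: sumr_ge0 => x _; apply: sumr_ge0.
  move=> x y; rewrite (bigD1 x)//= (bigD1 y)//= -addrA lerDl addr_ge0//.
    exact: sumr_ge0.
  by apply: sumr_ge0 => z _; apply: sumr_ge0.
(* Each further factor [A] sums n products, hence the rate n times a bound on the entries. *)
exists (n%:R * a); first by rewrite mulr_ge0.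
elim=> [|k ih] x y.
  by rewrite !expr0 mxE; case: (x == y); rewrite ?normr1// normr0.
rewrite exprS mxE (le_trans (ler_norm_sum _ _ _))//.
have -> : (n%:R * a) ^+ k.+1 = \sum_(z < n) a * (n%:R * a) ^+ k.
  by rewrite sumr_const card_ord -[RHS]mulr_natl exprS mulrA.
by apply: ler_sum => z _; rewrite normrM ler_pM.
Qed.

Lemma is_cvg_pseries_coef A x y t : cvgn (pseries (coef A x y) t).
Proof.
have [a a0 Aa] := expmx_bound A.
apply: normed_cvg.
apply: (@series_le_cvg _ _ (exp_coeff (a * `|t|))) => [k|k|k|].
- exact: normr_ge0.
- by rewrite exp_coeff_ge0// mulr_ge0.
- rewrite /exp_coeff/= /coef !normrM normrX normfV (ger0_norm (ler0n _ _)).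
  by rewrite exprMn mulrAC ler_wpM2r ?invr_ge0// ler_wpM2r ?exprn_ge0.
- exact: is_cvg_series_exp_coeff.
Qed.

(** Splitting A^(k+1) as A A^k leads to the backward equation; the splitting A^k A of
    [pseries_diffs_coefr] leads to the forward one. *)
Lemma pseries_diffs_coefl A x y :
  pseries_diffs (coef A x y) = (fun k => \sum_z A x z * coef A z y k).
Proof.
apply/funext => k; rewrite /pseries_diffs /coef exprS mxE factS natrM invfM.
rewrite mulrCA mulVKf ?pnatr_eq0// mulr_suml.
by apply: eq_bigr => z _; rewrite mulrA.
Qed.

Lemma pseries_diffs_coefr A x y :
  pseries_diffs (coef A x y) = (fun k => \sum_z coef A x z k * A z y).
Proof.
apply/funext => k; rewrite /pseries_diffs /coef exprSr mxE factS natrM invfM.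
rewrite mulrCA mulVKf ?pnatr_eq0// mulr_suml.
by apply: eq_bigr => z _; rewrite mulrAC.
Qed.

Lemma pseries_sumE (f : 'I_n -> R^nat) t :
  pseries (fun k => \sum_z f z k) t = series (fun k => \sum_z f z k * t ^+ k).
Proof.
rewrite /pseries; congr series; apply/funext => k.
by rewrite /= mulr_suml.
Qed.

Lemma is_cvg_pseriesZ (f : R^nat) (a t : R) :
  cvgn (pseries f t) -> cvgn (pseries (fun k => a * f k) t).
Proof.
move=> cf; rewrite /pseries.
have -> : [sequence a * f k * t ^+ k]_k = a *: (fun k => f k * t ^+ k) :> R^nat.
  by apply/funext => k /=; rewrite -mulrA.
exact: is_cvg_seriesZ.
Qed.

Lemma lim_pseriesZ (f : R^nat) (a t : R) :
  cvgn (pseries f t) ->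
  limn (pseries (fun k => a * f k) t) = a * limn (pseries f t).
Proof.
move=> cf; rewrite /pseries -[RHS]lim_seriesZ//; congr (limn (series _)).
by apply/funext => k /=; rewrite -mulrA.
Qed.

Lemma is_cvg_pseries_sum (f : 'I_n -> R^nat) t :
  (forall z, cvgn (pseries (f z) t)) ->
  cvgn (pseries (fun k => \sum_z f z k) t).
Proof.
move=> cf; rewrite pseries_sumE; apply/cvg_ex.
by exists (\sum_z limn (pseries (f z) t)); exact: cvg_series_sum.
Qed.

Lemma is_cvg_pseries_diffs_coef A x y t :
  cvgn (pseries (pseries_diffs (coef A x y)) t).
Proof.
rewrite pseries_diffs_coefl; apply: is_cvg_pseries_sum => z.
exact/is_cvg_pseriesZ/is_cvg_pseries_coef.
Qed.

Lemma is_derive_semigroup A t x y :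
  is_derive t 1 (fun s => semigroup A s x y)
    (limn (pseries (pseries_diffs (coef A x y)) t)).
Proof.
have -> : (fun s => semigroup A s x y) = fun s => limn (pseries (coef A x y) s).
  by apply/funext => s; exact: semigroupE.
apply: (@pseries_snd_diffs _ _ (`|t| + 1)).
- exact: is_cvg_pseries_coef.
- exact: is_cvg_pseries_diffs_coef.
- have -> : pseries_diffs (pseries_diffs (coef A x y)) =
      fun k => \sum_z A x z * pseries_diffs (coef A z y) k.
    apply/funext => k; rewrite [LHS]/pseries_diffs pseries_diffs_coefl mulr_sumr.
    by apply: eq_bigr => z _; rewrite mulrCA.
  apply: is_cvg_pseries_sum => z.
  exact/is_cvg_pseriesZ/is_cvg_pseries_diffs_coef.
- by rewrite [ltRHS]ger0_norm ?addr_ge0// ltrDl.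
Qed.

Lemma is_derive_semigroupl A t x y :
  is_derive t 1 (fun s => semigroup A s x y) ((A *m semigroup A t) x y).
Proof.
have := is_derive_semigroup A t x y.
rewrite pseries_diffs_coefl pseries_sumE lim_series_sum => [|z]; last first.
  exact/is_cvg_pseriesZ/is_cvg_pseries_coef.
rewrite mxE; congr is_derive; apply: eq_bigr => z _.
by rewrite semigroupE -lim_pseriesZ//; exact: is_cvg_pseries_coef.
Qed.

Lemma is_derive_semigroupr A t x y :
  is_derive t 1 (fun s => semigroup A s x y) ((semigroup A t *m A) x y).
Proof.
have := is_derive_semigroup A t x y.
have -> : pseries_diffs (coef A x y) = fun k => \sum_z A z y * coef A x z k.
  rewrite pseries_diffs_coefr; apply/funext => k.
  by apply: eq_bigr => z _; rewrite mulrC.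
rewrite pseries_sumE lim_series_sum => [|z]; last first.
  exact/is_cvg_pseriesZ/is_cvg_pseries_coef.
rewrite mxE; congr is_derive; apply: eq_bigr => z _.
by rewrite semigroupE mulrC -lim_pseriesZ//; exact: is_cvg_pseries_coef.
Qed.

Lemma semigroup0 A : semigroup A 0 = 1%:M.
Proof.
apply/matrixP => x y; rewrite semigroupE.
apply: cvg_lim => //; rewrite -cvg_shiftS/=.
have -> : (fun k => pseries (coef A x y) 0 k.+1) = fun=> 1%:M x y.
  apply/funext => k; rewrite /pseries /series/= big_nat_recl//=.
  rewrite big1 => [|i _]; last by rewrite exprS mul0r mulr0.
  by rewrite addr0 /coef !expr0 fact0 invr1 !mulr1.
exact: cvg_cst.
Qed.

(** All terms of the series are nonnegative, and the identity is the term of index 0. *)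
Lemma semigroup_ge_id A t x y : (forall x y, 0 <= A x y) -> 0 <= t ->
  1%:M x y <= semigroup A t x y.
Proof.
move=> A0 t0; rewrite semigroupE.
have Ak0 k z w : 0 <= (A ^+ k) z w.
  elim: k z w => [|k ih] z w; first by rewrite expr0 mxE.
  by rewrite exprS mxE sumr_ge0// => i _; rewrite mulr_ge0.
have -> : 1%:M x y = pseries (coef A x y) t 1%N.
  by rewrite /pseries/series/= big_nat1 /coef !expr0 fact0 invr1 !mulr1.
apply: nondecreasing_cvgn_le; last exact: is_cvg_pseries_coef.
apply: nondecreasing_series => k _ _.
by rewrite mulr_ge0// ?exprn_ge0// /coef mulr_ge0.
Qed.

(* Duhamel: s |-> e^{(t - s)A} z(s) is constant when z' = A z.                *)
Lemma linear_ode_sol A (z : R -> 'I_n -> R) t : 0 <= t ->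
  (forall s x, 0 <= s <= t ->
     is_derive s 1 (z ^~ x) (\sum_y A x y * z s y)) ->
  forall x, z t x = \sum_y semigroup A t x y * z 0 y.
Proof.
move=> t0 zd x.
pose f s := \sum_y semigroup A (-1 * s + t) x y * z s y.
have ft : f t = z t x.
  rewrite /f mulN1r addNr semigroup0 (bigD1 x)//= mxE eqxx mul1r big1 ?addr0//.
  by move=> y yx; rewrite mxE eq_sym (negPf yx) mul0r.
have f0 : f 0 = \sum_y semigroup A t x y * z 0 y by rewrite /f mulr0 add0r.
rewrite -ft -f0; apply: eq_of_derive_eq0 => // s st.
have : is_derive s 1 f (\sum_y
    (-1 * (semigroup A (-1 * s + t) *m A) x y * z s y +
     semigroup A (-1 * s + t) x y * \sum_w A y w * z s w)).
  apply: is_derive_fun_sum => y; apply: is_derive_fun_mul; last exact: zd.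
  apply: (@is_derive_affine_comp _ (fun s => semigroup A s x y)).
  exact: is_derive_semigroupr.
congr is_derive; rewrite big_split/=.
under eq_bigr => y _ do rewrite mxE mulN1r mulNr mulr_suml.
under [X in _ + X]eq_bigr => y _ do rewrite mulr_sumr.
rewrite sumrN exchange_big/= addrC; apply/eqP; rewrite subr_eq0; apply/eqP.
by apply: eq_bigr => y _; apply: eq_bigr => w _; rewrite mulrA.
Qed.

(* Shifting A by c I makes it entrywise nonnegative at the cost of the factor *)
(* e^{ct}.                                                                    *)
Lemma metzler_ode_ge A : (forall x y, x != y -> 0 <= A x y) ->
  exists c, forall (z : R -> 'I_n -> R) t, 0 <= t ->
  (forall s x, 0 <= s <= t ->
     is_derive s 1 (z ^~ x) (\sum_y A x y * z s y)) ->
  (forall x, 0 <= z 0 x) ->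
  forall x, expR (- c * t) * z 0 x <= z t x.
Proof.
move=> A0; pose c := \sum_x `|A x x|.
have Bge0 x y : 0 <= (A + c%:M) x y.
  rewrite !mxE; have [<-|xy] := eqVneq x y; last by rewrite addr0 A0.
  rewrite mulr1n -lerBlDr sub0r /c (bigD1 x)//=.
  rewrite lerNl (le_trans (ler_norm _))// normrN lerDl.
  exact: sumr_ge0.
exists c => z t t0 zd z0 x.
rewrite mulNr expRN ler_pdivrMl ?expR_gt0//.
(* [v] solves v' = (A + c I) v with a nonnegative matrix, so it dominates its initial value. *)
pose v s x := expR (c * s) * z s x.
have vd s y : 0 <= s <= t ->
    is_derive s 1 (v ^~ y) (\sum_w (A + c%:M) y w * v s w).
  move=> st; have := is_derive_fun_mul (is_derive_expRM c s) (zd s y st).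
  congr is_derive; under [RHS]eq_bigr => w _ do rewrite !mxE mulrDl.
  rewrite big_split/= [LHS]addrC; congr (_ + _).
    by rewrite mulr_sumr; apply: eq_bigr => w _; rewrite mulrCA.
  rewrite (bigD1 y)//= eqxx mulr1n big1 ?addr0 ?mulrA// => w wy.
  by rewrite eq_sym (negPf wy) mulr0n mul0r.
rewrite -[expR _ * z t x]/(v t x) (linear_ode_sol t0 vd).
have v0 y : v 0 y = z 0 y by rewrite /v mulr0 expR0 mul1r.
rewrite -v0 (bigD1 x)//= -[leLHS]addr0 lerD ?sumr_ge0//.
  rewrite ler_peMl ?v0//; have := @semigroup_ge_id (A + c%:M) t x x Bge0 t0.
  by rewrite mxE eqxx.
move=> y _; rewrite mulr_ge0 ?v0//.
by apply: le_trans (semigroup_ge_id x y Bge0 t0); rewrite mxE.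
Qed.

End matrix_exponential.

(** * The functions x log x and (a - b)(log a - log b) *)

Section entropy_functions.
Context {R : realType}.
Implicit Types (a b x y : R).

Lemma le_ln_subr1 x : 0 < x -> ln x <= x - 1.
Proof.
move=> x0; have -> : ln x = ln (1 + (x - 1)) by congr ln; ring.
by apply: le_ln1Dx; lra.
Qed.

Lemma ge_ln_1subV x : 0 < x -> 1 - x^-1 <= ln x.
Proof.
move=> x0; have := @le_ln_subr1 x^-1; rewrite invr_gt0 => /(_ x0).
by rewrite lnV ?posrE//; lra.
Qed.

(** Convexity of x log x, obtained from 1 - 1/r <= log r at r = x / y. *)
Lemma xlnx_tangent x y : 0 <= x -> 0 < y ->
  y * ln y + (ln y + 1) * (x - y) <= x * ln x.
Proof.
rewrite le_eqVlt => /predU1P[<-|x0] y0; first by rewrite mul0r; lra.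
have := @ge_ln_1subV (x / y); rewrite divr_gt0// ln_div ?posrE// => /(_ erefl).
rewrite -(ler_pM2l x0) invf_div mulrBr mulr1 [x * (y / x)]mulrCA divff ?gt_eqF//.
lra.
Qed.

Lemma xlnx_superadditive x y : 0 <= x -> 0 <= y ->
  x * ln x + y * ln y <= (x + y) * ln (x + y).
Proof.
move=> x0 y0.
have h z w : 0 <= z -> 0 <= w -> z * ln z <= z * ln (z + w).
rewrite le_eqVlt => /predU1P[<-|z0 w0]; first by rewrite !mul0r.
by rewrite ler_wpM2l ?(ltW z0)// ler_ln ?posrE ?ltr_wpDr// lerDl.
by rewrite mulrDl lerD ?h// addrC h.
Qed.

(** The partial derivative of [phi] in its first argument; by symmetry of [phi], the other one is
    [dphi b a]. *)
Definition dphi a b := ln a - ln b + 1 - b / a.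

Definition phi a b := (a - b) * (ln a - ln b).

Lemma phixx a : phi a a = 0. Proof. by rewrite /phi subrr mul0r. Qed.

Lemma phi_euler a b : 0 < a -> 0 < b ->
  phi a b = dphi a b * a + dphi b a * b.
Proof.
move=> a0 b0; rewrite /phi /dphi; field.
by rewrite !gt_eqF.
Qed.

(* phi is convex and 1-homogeneous, so it dominates its differential at any   *)
(* other point.                                                               *)
Lemma phi_ge_differential a b x y : 0 < a -> 0 < b -> 0 < x -> 0 < y ->
  dphi a b * x + dphi b a * y <= phi x y.
Proof.
move=> a0 b0 x0 y0.
(* In terms of [r] the gap between the two sides is x (log r - 1 + 1/r) + y (r - 1 - log r), a sum
   of two nonnegative terms. *)
pose r := (x / y) / (a / b).
have r0 : 0 < r by rewrite !divr_gt0.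
have lnr : ln r = ln x - ln y - (ln a - ln b).
  by rewrite !ln_div ?posrE// divr_gt0.
have h1 : x * (1 - r^-1) <= x * ln r by rewrite ler_wpM2l ?ge_ln_1subV// ltW.
have h2 : y * ln r <= y * (r - 1) by rewrite ler_wpM2l ?le_ln_subr1// ltW.
have e1 : x * r^-1 = y * a / b by rewrite /r; field; rewrite !gt_eqF.
have e2 : y * r = x * b / a by rewrite /r; field; rewrite !gt_eqF.
move: h1 h2; rewrite mulrBr mulr1 e1 [y * (r - 1)]mulrBr mulr1 e2 lnr => h1 h2.
rewrite /phi /dphi.
rewrite [(_ - b / a) * x]mulrBl [(_ - a / b) * y]mulrBl.
have -> : b / a * x = x * b / a by rewrite mulrAC [b * x]mulrC.
have -> : a / b * y = y * a / b by rewrite mulrAC [a * y]mulrC.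
lra.
Qed.

(** The derivative of log is at least 1/M up to [M], so the logarithmic factor of [phi] is at least
    |a - b| / M. *)
Lemma phi_ge_sqr a b M : 0 < a -> 0 < b -> a <= M -> b <= M ->
  (a - b) ^+ 2 <= M * phi a b.
Proof.
wlog ab : a b / a <= b.
  move=> h a0 b0 aM bM; have [ab|/ltW ba] := leP a b; first exact: h.
  by have := h b a ba b0 a0 bM aM; rewrite /phi; lra.
move=> a0 b0 aM bM.
have M0 : 0 < M := lt_le_trans a0 aM.
have : 1 - (b / a)^-1 <= ln (b / a) by rewrite ge_ln_1subV ?divr_gt0.
rewrite invf_div ln_div ?posrE// => h.
have h2 : b - a <= b * (ln b - ln a).
  have : b * (1 - a / b) <= b * (ln b - ln a) by rewrite ler_wpM2l// ltW.
  by rewrite mulrBr mulr1 [b * (a / b)]mulrCA divff ?gt_eqF// mulr1.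
have l0 : 0 <= ln b - ln a by rewrite subr_ge0 ler_ln ?posrE.
have h3 : b * (ln b - ln a) <= M * (ln b - ln a) by rewrite ler_wpM2r.
have h4 : (b - a) * (b - a) <= (b - a) * (M * (ln b - ln a)).
  by rewrite ler_wpM2l ?subr_ge0// (le_trans h2).
rewrite /phi expr2; lra.
Qed.

Lemma phi_ge0 a b : 0 < a -> 0 < b -> 0 <= phi a b.
Proof.
move=> a0 b0; have M0 : 0 < Num.max a b by rewrite lt_max a0.
rewrite -(pmulr_rge0 _ M0) (le_trans (sqr_ge0 (a - b)))//.
by rewrite phi_ge_sqr// le_max lexx ?orbT.
Qed.

Lemma is_derive_ln_comp (f : R -> R) df t : 0 < f t -> is_derive t 1 f df ->
  is_derive t 1 (fun s => ln (f s)) (df / f t).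
Proof.
move=> f0 fd; have := @is_derive1_comp R (@ln R) f t _ _ (is_derive1_ln f0) fd.
by rewrite /GRing.scale/= mulrC.
Qed.

Lemma is_derive_xlnx (f : R -> R) df t : 0 < f t -> is_derive t 1 f df ->
  is_derive t 1 (fun s => f s * ln (f s)) ((ln (f t) + 1) * df).
Proof.
move=> f0 fd; have := is_derive_fun_mul fd (is_derive_ln_comp f0 fd).
by congr is_derive; field; rewrite gt_eqF.
Qed.

Lemma is_derive_phi (f g : R -> R) df dg t : 0 < f t -> 0 < g t ->
  is_derive t 1 f df -> is_derive t 1 g dg ->
  is_derive t 1 (fun s => phi (f s) (g s))
    (dphi (f t) (g t) * df + dphi (g t) (f t) * dg).
Proof.
move=> f0 g0 fd gd.
have := is_derive_fun_mul (is_deriveB fd gd)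
  (is_deriveB (is_derive_ln_comp f0 fd) (is_derive_ln_comp g0 gd)).
congr is_derive; rewrite !fctE /dphi; field.
by rewrite !gt_eqF.
Qed.

End entropy_functions.

(** * Birth and death generators and the chain of edges *)

Section states.
Context {n : nat}.
Implicit Types x : 'I_n.

Lemma val_state_up x : (x.+1 < n)%N -> state_up x = x.+1 :> nat.
Proof. by move=> xn; rewrite -[LHS]/(val _) /state_up val_insubd xn. Qed.

Lemma state_up_last x : ~~ (x.+1 < n)%N -> state_up x = x.
Proof. by move=> xn; apply: val_inj; rewrite /state_up val_insubd (negPf xn). Qed.

Lemma val_state_down x : state_down x = x.-1 :> nat.
Proof.
rewrite -[LHS]/(val _) /state_down val_insubd.
by rewrite (leq_ltn_trans (leq_pred x) (ltn_ord x)).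
Qed.

Lemma state_upK x : (x.+1 < n)%N -> state_down (state_up x) = x.
Proof. by move=> xn; apply: val_inj; rewrite /= val_state_down val_state_up. Qed.

Lemma state_downK x : (0 < x)%N -> state_up (state_down x) = x.
Proof.
move=> x0; apply: val_inj.
by rewrite /= val_state_up val_state_down prednK// ltn_ord.
Qed.

(** The left side is the condition that [reindex_onto] produces when a sum over the states above the
    first is reindexed by [state_up]. *)
Lemma state_up_positiveE x :
  (0 < state_up x)%N && (state_down (state_up x) == x) = (x.+1 < n)%N.
Proof.
have [xn|xn] := boolP (x.+1 < n)%N.
  by rewrite state_upK// eqxx val_state_up.
rewrite state_up_last//; apply/negP => /andP[x0 /eqP/(congr1 val)].
by rewrite /= val_state_down => e; lia.
Qed.

End states.

Section birth_death_generator.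
Context {R : realType} {n : nat}.
Variables qp qm : 'I_n -> R.
Hypothesis hq : bd_rates qp qm.
Implicit Types (f g h : 'I_n -> R) (x y : 'I_n).

Lemma qp_ge0 x : 0 <= qp x.
Proof.
have [q1 q2 _ _] := hq; have [xn|xn] := boolP (x.+1 < n)%N.
  by rewrite ltW ?q1.
by rewrite q2//; apply/eqP; rewrite eqn_leq ltn_ord leqNgt.
Qed.

Lemma qm_ge0 x : 0 <= qm x.
Proof.
have [_ _ q1 q2] := hq; have [x0|] := boolP (0 < x)%N; first by rewrite ltW ?q1.
by rewrite -eqn0Ngt => /eqP /q2 ->.
Qed.

Lemma qp_last x : ~~ (x.+1 < n)%N -> qp x = 0.
Proof.
have [_ q2 _ _] := hq => xn; apply: q2.
by apply/eqP; rewrite eqn_leq ltn_ord leqNgt.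
Qed.

Lemma qm_first x : ~~ (0 < x)%N -> qm x = 0.
Proof. by have [_ _ _ q2] := hq; rewrite -eqn0Ngt => /eqP /q2. Qed.

Lemma sum_delta f x : \sum_y (x == y)%:R * f y = f x.
Proof.
rewrite (bigD1 x)//= eqxx mul1r big1 ?addr0// => y yx.
by rewrite eq_sym (negPf yx) mul0r.
Qed.

Lemma bd_gen_sum f x : bd_gen qp qm f x = \sum_y bd_mx qp qm x y * f y.
Proof.
under eq_bigr => y _ do rewrite mxE /bd_gen mulrDl -!mulrA !mulrBl.
by rewrite big_split/= -!mulr_sumr !sumrB !sum_delta.
Qed.

Lemma bd_mx_metzler x y : x != y -> 0 <= bd_mx qp qm x y.
Proof.
move=> xy; rewrite mxE /bd_gen (negPf xy) !subr0.
by rewrite addr_ge0// mulr_ge0 ?qp_ge0 ?qm_ge0.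
Qed.

Lemma bd_mx_rowsum x : \sum_y bd_mx qp qm x y = 0.
Proof.
have := bd_gen_sum (fun=> 1) x; rewrite /bd_gen !subrr !mulr0 addr0.
by under [X in _ = X]eq_bigr do rewrite mulr1.
Qed.

(* The generator of the killed chain of edges {x, x + 1}, each edge being     *)
(* labelled by its lower end point.                                           *)
Definition edge_gen f x : R :=
  qm x * f (state_down x) + qp (state_up x) * f (state_up x)
  - (qm (state_up x) + qp x) * f x.

(** The discrete gradient intertwines the two generators; at the first state the missing lower
    neighbour is hidden by q_-(1) = 0. *)
Lemma edge_gen_increment f x : (x.+1 < n)%N ->
  edge_gen (fun y => f (state_up y) - f y) x =
  bd_gen qp qm f (state_up x) - bd_gen qp qm f x.
Proof.
move=> xn; rewrite /edge_gen /bd_gen state_upK//.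
have [x0|x0] := boolP (0 < x)%N; first by rewrite state_downK//; ring.
by rewrite (qm_first x0); ring.
Qed.

(** The last state is the lower end point of no edge: its row is zero, which freezes that
    coordinate. *)
Let edge_mx : 'M[R]_n := \matrix_(x, y) if (x.+1 < n)%N then
  edge_gen (fun z => (z == y)%:R) x else 0.

Lemma edge_gen_ode_ge0 (v : R -> 'I_n -> R) (t : R) : 0 <= t ->
  (forall (s : R) x, 0 <= s <= t -> (x.+1 < n)%N ->
     is_derive s 1 (v ^~ x) (edge_gen (v s) x)) ->
  (forall (s : R) x, 0 <= s <= t -> ~~ (x.+1 < n)%N ->
     is_derive s 1 (v ^~ x) 0) ->
  (forall x, 0 <= v 0 x) -> forall x, 0 <= v t x.
Proof.
move=> t0 vd vd0 v0 x.
have [|c /(_ v t t0)] := @metzler_ode_ge _ _ edge_mx.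
  move=> y z yz; rewrite mxE; case: ifP => // _.
  rewrite /edge_gen (negPf yz) mulr0 subr0 addr_ge0// mulr_ge0//.
    exact: qm_ge0.
  exact: qp_ge0.
move=> h; apply: le_trans (h _ v0 x); first by rewrite mulr_ge0// expR_ge0.
move=> s y st; have [yn|yn] := boolP (y.+1 < n)%N; last first.
  have := vd0 s y st yn; congr is_derive; apply/esym/big1 => z _.
  by rewrite mxE (negPf yn) mul0r.
have := vd s y st yn; congr is_derive.
under eq_bigr => z _ do
  rewrite mxE yn /edge_gen mulrBl mulrDl -!mulrA.
by rewrite !big_split/= sumrN -!mulr_sumr !sum_delta.
Qed.

(** * Summation by parts under detailed balance *)

Section reversible.
Variable p : 'I_n -> R.
Hypothesis detailed_balance : forall x, (x.+1 < n)%N ->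
  p x * qp x = p (state_up x) * qm (state_up x).

(** Detailed balance equates the downward and upward flows across each edge; the boundary terms
    vanish with their rates. *)
Lemma sum_flow_shift (F : 'I_n -> 'I_n -> R) :
  \sum_x p x * qm x * F x (state_down x) =
  \sum_x p x * qp x * F (state_up x) x.
Proof.
rewrite (bigID (fun x : 'I_n => 0 < x)%N)/= [X in _ + X]big1 ?addr0; last first.
  by move=> x x0; rewrite qm_first// mulr0 mul0r.
rewrite [RHS](bigID (fun x : 'I_n => x.+1 < n)%N)/= [X in _ = _ + X]big1 ?addr0;
  last by move=> x x0; rewrite qp_last// mulr0 mul0r.
rewrite (reindex_onto (@state_up n) (@state_down n))/=; last first.
  by move=> x; exact: state_downK.
apply: eq_big => [x|x]; rewrite state_up_positiveE// => xn.
by rewrite state_upK// detailed_balance.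
Qed.

Lemma dirichlet_form f h :
  \sum_x p x * f x * bd_gen qp qm h x =
  - \sum_x p x * qp x * ((f (state_up x) - f x) * (h (state_up x) - h x)).
Proof.
under eq_bigr => x _ do rewrite /bd_gen mulrDr.
rewrite big_split/=.
have -> : \sum_x p x * f x * (qm x * (h (state_down x) - h x)) =
    \sum_x p x * qm x * (f x * (h (state_down x) - h x)).
  by apply: eq_bigr => x _; ring.
rewrite (sum_flow_shift (fun x y => f x * (h y - h x))) -big_split -sumrN/=.
by apply: eq_bigr => x _; ring.
Qed.

(** The Dirichlet form is symmetric; it is applied here to two indicators. *)
Lemma bd_mx_reversible x y : p x * bd_mx qp qm x y = p y * bd_mx qp qm y x.
Proof.
have e a b : p a * bd_mx qp qm a b =
    \sum_z p z * (z == a)%:R * bd_gen qp qm (fun w => (w == b)%:R) z.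
  rewrite -(sum_delta (fun z => p z * bd_mx qp qm z b)).
  by apply: eq_bigr => z _; rewrite [z == a]eq_sym [in LHS]mxE; ring.
rewrite !e !(dirichlet_form (fun z => (z == _)%:R)).
by congr (- _); apply: eq_bigr => z _; ring.
Qed.

(** The weights c = p q_+ satisfy c(x) q_-(x) = c(x - 1) q_+(x), which is detailed balance for the
    moves of edges. *)
Lemma edge_gen_reversible f h :
  \sum_x p x * qp x * (f x * edge_gen h x) =
  \sum_x p x * qp x * (h x * edge_gen f x).
Proof.
have e a b : \sum_x p x * qp x * (a x * edge_gen b x) =
    \sum_x p x * qp x * (qp (state_up x) *
      (a (state_up x) * b x + a x * b (state_up x)) -
      (qm (state_up x) + qp x) * a x * b x).
  transitivity (\sum_x p x * qm x * (qp x * a x * b (state_down x)) +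
    \sum_x p x * qp x * (qp (state_up x) * a x * b (state_up x) -
      (qm (state_up x) + qp x) * a x * b x)).
    by rewrite -big_split/=; apply: eq_bigr => x _; rewrite /edge_gen; ring.
  rewrite (sum_flow_shift (fun x y => qp x * a x * b y)) -big_split/=.
  by apply: eq_bigr => x _; ring.
by rewrite !e; apply: eq_bigr => x _; ring.
Qed.
End reversible.
End birth_death_generator.

(** * The invariant law *)

Section invariant_law.
Context {R : realType} {n : nat}.
Variables qp qm : 'I_n -> R.
Hypothesis hq : bd_rates qp qm.
Variable pi : 'rV[R]_n.
Hypothesis hpi : invariant_law (bd_mx qp qm) pi.
Implicit Types (f : 'I_n -> R) (x y : 'I_n).

Lemma is_derive_evolution (A : 'M[R]_n) (mu : 'rV[R]_n) (t : R) x :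
  is_derive t 1 (fun s => (mu *m semigroup A s) 0 x)
    ((mu *m semigroup A t *m A) 0 x).
Proof.
have -> : (fun s => (mu *m semigroup A s) 0 x) =
    fun s => \sum_y mu 0 y * semigroup A s y x.
  by apply/funext => s; rewrite mxE.
rewrite -mulmxA mxE; apply: is_derive_fun_sum => y.
exact/is_derive_mull/is_derive_semigroupr.
Qed.

Lemma invariant_law_gen0 : pi *m bd_mx qp qm = 0.
Proof.
have [_ inv] := hpi; apply/rowP => x; rewrite [RHS]mxE; set d := LHS.
(* The first term is constant on s >= 0, yet its derivative there is [d]; comparing the times 0 and
   1 gives d = 0. *)
pose f s := (pi *m semigroup (bd_mx qp qm) s) 0 x - d * s.
have f01 : f 1 = f 0.
  apply: eq_of_derive_eq0; first exact: ler01.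
  move=> s /andP[s0 _].
  have := is_deriveB (is_derive_evolution (bd_mx qp qm) pi s x)
    (is_derive_mull d (is_derive_id s 1)).
  by rewrite inv// mulr1 subrr.
by move: f01; rewrite /f !inv//; lra.
Qed.

Lemma invariant_law_gen_sum0 f : \sum_x pi 0 x * bd_gen qp qm f x = 0.
Proof.
under eq_bigr => x _ do rewrite bd_gen_sum mulr_sumr.
rewrite exchange_big big1//= => y _.
under eq_bigr => x _ do rewrite mulrA.
rewrite -mulr_suml; have /rowP/(_ y) := invariant_law_gen0.
by rewrite !mxE => ->; rewrite mul0r.
Qed.

(* The flow through the edge {x, x + 1} vanishes: test invariance against the *)
(* indicator of the states above x.                                           *)
Lemma invariant_law_detailed_balance x : (x.+1 < n)%N ->
  pi 0 x * qp x = pi 0 (state_up x) * qm (state_up x).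
Proof.
move=> xn; pose f y : R := (x < y)%N%:R.
have xux : state_up x != x.
  by rewrite -val_eqE/= val_state_up// neq_ltn ltnSn orbT.
have := invariant_law_gen_sum0 f.
rewrite (bigD1 x)//= (bigD1 (state_up x))//= big1 ?addr0.
  rewrite /bd_gen state_upK// /f (val_state_up xn) val_state_down.
  have [xn2|xn2] := boolP (x.+2 < n)%N.
    rewrite (@val_state_up _ (state_up x)) ?val_state_up//=.
    rewrite ltnn !ltnS leqnSn leqnn.
    have -> : (x < x.-1)%N = false by lia.
    by rewrite /=; lra.
  rewrite (@state_up_last _ (state_up x)) ?val_state_up//= ltnn ltnS leqnn.
  have -> : (x < x.-1)%N = false by lia.
  by rewrite /=; lra.
move=> y /andP[yx yux]; rewrite /bd_gen /f val_state_down.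
have yx' : y <> x :> nat by move/val_inj/eqP; rewrite (negPf yx).
have yux' : y <> x.+1 :> nat.
  by rewrite -val_state_up// => /val_inj/eqP; rewrite (negPf yux).
have -> : (x < y.-1)%N = (x < y)%N by move: yx' yux' => /=; lia.
have [yn|yn] := boolP (y.+1 < n)%N.
  rewrite val_state_up//; have -> : (x < y.+1)%N = (x < y)%N.
    by move: yx' => /=; lia.
  by rewrite !subrr !mulr0 addr0 mulr0.
by rewrite state_up_last// !subrr !mulr0 addr0 mulr0.
Qed.

(** By detailed balance with positive rates, a zero of [pi] would spread to every state, against
    total mass 1. *)
Lemma invariant_law_pos x : 0 < pi 0 x.
Proof.
have [[pi0 pi1] _] := hpi.
have [q1 _ q2 _] := hq.
have step y : (y.+1 < n)%N -> (pi 0 y == 0) = (pi 0 (state_up y) == 0).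
  move=> yn; have := invariant_law_detailed_balance yn.
  have qy := q1 y yn.
  have qy' : 0 < qm (state_up y) by rewrite q2// val_state_up.
  move=> e; apply/eqP/eqP => e0; apply/eqP.
    by move/eqP: e; rewrite e0 mul0r eq_sym mulf_eq0 (gt_eqF qy') orbF.
  by move/eqP: e; rewrite e0 mul0r mulf_eq0 (gt_eqF qy) orbF.
rewrite lt_def pi0 andbT; apply/negP => px0.
pose o := Ordinal (leq_ltn_trans (leq0n x) (ltn_ord x)).
suff pz k y : y = k :> nat -> (pi 0 y == 0) = (pi 0 o == 0).
  have : \sum_y pi 0 y = 0.
    by apply: big1 => y _; apply/eqP; rewrite (pz _ y erefl) -(pz _ x erefl).
  by rewrite pi1 => /eqP; rewrite oner_eq0.
elim: k y => [|k ih] y yk; first by congr (pi 0 _ == 0); apply: val_inj.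
have y0 : (0 < y)%N by rewrite yk.
rewrite -(ih (state_down y)) ?val_state_down ?yk// -{1}(state_downK y0).
by rewrite -step// val_state_down prednK.
Qed.

End invariant_law.

(** * Entropy and its dissipation *)

Lemma finite_lower_bound {R : realType} (I : finType) (f : I -> R) :
  (forall i, 0 < f i) -> exists2 e, 0 < e & forall i, e <= f i.
Proof.
(* The summand 1 keeps the witness positive when [I] is empty. *)
move=> f0; exists (1 + \sum_i (f i)^-1)^-1.
  by rewrite invr_gt0 ltr_pwDl// sumr_ge0// => i _; rewrite invr_ge0 ltW.
move=> i; rewrite -[leRHS]invrK lef_pV2 ?posrE ?invr_gt0//.
  rewrite (bigD1 i)//= addrCA lerDl addr_ge0// sumr_ge0// => j _.
  by rewrite invr_ge0 ltW.
by rewrite ltr_pwDl// sumr_ge0// => j _; rewrite invr_ge0 ltW.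
Qed.

Section entropy_decay.
Context {R : realType} {n : nat}.
Variables qp qm : 'I_n -> R.
Hypothesis hq : bd_rates qp qm.
Variable p : 'I_n -> R.
Hypothesis p_gt0 : forall x, 0 < p x.
Hypothesis p_sum1 : \sum_x p x = 1.
Hypothesis detailed_balance : forall x : 'I_n, (x.+1 < n)%N ->
  p x * qp x = p (state_up x) * qm (state_up x).
Implicit Types (f g : 'I_n -> R) (x y : 'I_n) (s t m D : R).

Definition entropy g : R := \sum_x p x * (g x * ln (g x)).

Definition dissipation g : R :=
  \sum_x p x * qp x * phi (g x) (g (state_up x)).

Let p_ge0 x : 0 <= p x. Proof. exact: ltW. Qed.

Let c_ge0 x : 0 <= p x * qp x.
Proof. by rewrite mulr_ge0// (qp_ge0 hq). Qed.

Lemma entropy_ge0 g : (forall x, 0 <= g x) -> \sum_x p x * g x = 1 ->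
  0 <= entropy g.
Proof.
move=> g0 g1; have -> : 0 = \sum_x p x * (g x - 1) :> R.
  under eq_bigr do rewrite mulrBr mulr1.
  by rewrite sumrB g1 p_sum1 subrr.
apply: ler_sum => x _; rewrite ler_wpM2l//.
by have := xlnx_tangent (g0 x) ltr01; rewrite ln1; lra.
Qed.

Lemma dissipation_ge0 g : (forall x, 0 < g x) -> 0 <= dissipation g.
Proof. by move=> g0; apply: sumr_ge0 => x _; rewrite mulr_ge0 ?phi_ge0. Qed.

(** Mass 1 bounds the density by the inverse of the least weight, so [phi_ge_sqr] applies with a
    uniform [M]. *)
Lemma dissipation_ge_oscillation : exists2 e, 0 < e & forall g,
  (forall x, 0 < g x) -> \sum_x p x * g x = 1 ->
  forall x, e * (g (state_up x) - g x) ^+ 2 <= dissipation g.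
Proof.
have [e e0 ep] := finite_lower_bound p_gt0.
(* The value 1 at the last state replaces the zero rate q_+(n), which would spoil positivity. *)
have [|d d0 dc] := @finite_lower_bound _ _
    (fun x : 'I_n => if (x.+1 < n)%N then p x * qp x else 1).
  move=> x; case: ifP => // xn; rewrite mulr_gt0//.
  by have [q1 _ _ _] := hq; exact: q1.
exists (e * d); first exact: mulr_gt0.
move=> g g0 g1 x; have [xn|xn] := boolP (x.+1 < n)%N; last first.
  by rewrite state_up_last// subrr expr0n mulr0 dissipation_ge0.
have gM y : g y <= e^-1.
  rewrite -[leRHS]mul1r ler_pdivlMr// -g1 (bigD1 y)//= mulrC.
  rewrite ler_wpDr ?sumr_ge0// => [z _|]; first by rewrite mulr_ge0// ltW.
  by rewrite ler_wpM2r// ltW.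
have := phi_ge_sqr (g0 x) (g0 (state_up x)) (gM x) (gM (state_up x)).
rewrite ler_pdivlMl// => h.
have -> : e * d * (g (state_up x) - g x) ^+ 2 =
  d * (e * (g x - g (state_up x)) ^+ 2) by ring.
apply: (@le_trans _ _ (p x * qp x * phi (g x) (g (state_up x)))).
  apply: ler_pM => //; first exact: ltW.
    by rewrite mulr_ge0 ?sqr_ge0// ltW.
  by have := dc x; rewrite xn.
rewrite /dissipation (bigD1 x)//= lerDl sumr_ge0// => y _.
by rewrite mulr_ge0 ?phi_ge0.
Qed.

Lemma dist_le_increments g D x y : (forall x, `|g (state_up x) - g x| <= D) ->
  `|g x - g y| <= n%:R * D.
Proof.
move=> gD; have D0 : 0 <= D := le_trans (normr_ge0 _) (gD x).
have h k (z w : 'I_n) : w = (z + k)%N :> nat -> `|g w - g z| <= k%:R * D.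
  elim: k z w => [|k ih] z w wz.
    have -> : w = z by apply: val_inj; rewrite /= wz addn0.
    by rewrite subrr normr0 mul0r.
  have zn : (z.+1 < n)%N by rewrite (leq_ltn_trans _ (ltn_ord w))// wz; lia.
  rewrite -(subrK (g (state_up z)) (g w)) -addrA (le_trans (ler_normD _ _))//.
  rewrite -natr1 mulrDl mul1r lerD//.
  by apply: ih; rewrite val_state_up// wz; lia.
wlog xy : x y / (y <= x)%N.
  by move=> hw; have [/hw//|/ltnW/hw] := leqP y x; rewrite distrC.
rewrite (le_trans (h (x - y)%N y x _)) ?subnKC//.
by rewrite ler_wpM2r// ler_nat (leq_trans (leq_subr _ _))// ltnW.
Qed.

(** A modified logarithmic Sobolev inequality with a crude constant: the entropy is at most the
    variance, which the increments control. Any positive constant makes the entropy decay to 0. *)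
Lemma dissipation_ge_entropy : exists2 k, 0 < k & forall g,
  (forall x, 0 < g x) -> \sum_x p x * g x = 1 ->
  k * entropy g <= dissipation g.
Proof.
have [e e0 he] := dissipation_ge_oscillation.
have n0 : 0 < n%:R :> R.
  rewrite ltr0n lt0n; apply/eqP => n0; move: p_sum1.
  rewrite big1 => [/eqP|x _]; first by rewrite eq_sym oner_eq0.
  by move: (ltn_ord x); rewrite {2}n0.
exists (e / n%:R ^+ 2); first by rewrite divr_gt0// exprn_gt0.
move=> g g0 g1; set D := Num.sqrt (dissipation g / e).
have De : e * D ^+ 2 = dissipation g.
  rewrite sqr_sqrtr; first by rewrite mulrC divfK// gt_eqF.
  by rewrite divr_ge0 ?dissipation_ge0// ltW.
have avg r : \sum_x p x * r = r by rewrite -mulr_suml p_sum1 mul1r.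
have gD x : `|g (state_up x) - g x| <= D.
  rewrite -ler_sqr ?nnegrE ?sqrtr_ge0// -normrX ger0_norm ?sqr_ge0//.
  by rewrite -(ler_pM2l e0) De he.
have g1D x : (g x - 1) ^+ 2 <= (n%:R * D) ^+ 2.
  rewrite -[leLHS]ger0_norm ?sqr_ge0// normrX ler_sqr ?nnegrE//; last first.
    by rewrite mulr_ge0 ?sqrtr_ge0// ltW.
  have -> : g x - 1 = \sum_y p y * (g x - g y).
    under eq_bigr do rewrite mulrBr.
    by rewrite sumrB g1 -mulr_suml p_sum1 mul1r.
  apply: (le_trans (ler_norm_sum _ _ _)).
  rewrite -(avg (n%:R * D)); apply: ler_sum => y _.
  by rewrite normrM gtr0_norm// ler_wpM2l// dist_le_increments.
have : entropy g <= (n%:R * D) ^+ 2.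
  apply: (@le_trans _ _ (\sum_x p x * (g x - 1) ^+ 2)).
    (* The two sides differ by the mean of g - 1, which is zero. *)
    have -> : \sum_x p x * (g x - 1) ^+ 2 = \sum_x p x * (g x * (g x - 1)).
      apply/eqP; rewrite -subr_eq0 -sumrB/=.
      rewrite (eq_bigr (fun x => p x - p x * g x)) => [|x _]; last by ring.
      by rewrite sumrB p_sum1 g1 subrr.
    apply: ler_sum => x _; rewrite ler_wpM2l// ler_wpM2l ?le_ln_subr1//.
    exact: ltW.
  rewrite -(avg ((n%:R * D) ^+ 2)); apply: ler_sum => x _.
  by rewrite ler_wpM2l.
rewrite exprMn => h; rewrite mulrAC ler_pdivrMr ?exprn_gt0//.
by rewrite -De -mulrA [D ^+ 2 * _]mulrC ler_wpM2l// ltW.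
Qed.

(** * Contraction of dissipation and entropy along the heat flow *)

Section heat_flow.
Hypothesis hmono : forall x : 'I_n, (x.+1 < n)%N ->
  qp (state_up x) <= qp x /\ qm x <= qm (state_up x).
Variable g : R -> 'I_n -> R.
Hypothesis g_derive : forall s x, 0 <= s ->
  is_derive s 1 (g ^~ x) (bd_gen qp qm (g s) x).
Hypothesis g_gt0 : forall s x, 0 <= s -> 0 < g s x.
Hypothesis g_mass : forall s, 0 <= s -> \sum_x p x * g s x = 1.

(** This is the Dirichlet form of log g + 1 against g; the constant 1 disappears from the
    increments. *)
Lemma is_derive_entropy s : 0 <= s ->
  is_derive s 1 (fun s => entropy (g s)) (- dissipation (g s)).
Proof.
move=> s0; have : is_derive s 1 (fun s => entropy (g s))
    (\sum_x p x * ((ln (g s x) + 1) * bd_gen qp qm (g s) x)).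
  apply: is_derive_fun_sum => x; apply: is_derive_mull.
  by apply: is_derive_xlnx; [exact: g_gt0|exact: g_derive].
congr is_derive; under eq_bigr do rewrite mulrA.
rewrite (dirichlet_form hq detailed_balance (fun x => ln (g s x) + 1)).
congr (- _); apply: eq_bigr => x _; rewrite /phi; ring.
Qed.

Lemma entropy_exp_decay : exists2 k, 0 < k & forall s, 0 <= s ->
  expR (k * s) * entropy (g s) <= entropy (g 0).
Proof.
have [k k0 hk] := dissipation_ge_entropy.
exists k => // s s0.
have := @le_of_derive_le0 R (fun s => expR (k * s) * entropy (g s))
  (fun s => k * expR (k * s) * entropy (g s)
            + expR (k * s) * - dissipation (g s)) 0 s s0.
rewrite mulr0 expR0 mul1r; apply=> [r /andP[r0 _]|r /andP[r0 _]].
  apply: is_derive_fun_mul; first exact: is_derive_expRM.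
  exact: is_derive_entropy.
rewrite mulrN subr_le0 mulrAC mulrC ler_wpM2l ?expR_ge0// hk//.
  by move=> x; exact: g_gt0.
exact: g_mass.
Qed.

(* Each transition of a state pair (x, x + 1) under the monotone coupling     *)
(* either moves the edge or collapses it, and phi vanishes on the diagonal.   *)
Lemma phi_derive_le_edge_gen s x : 0 <= s -> (x.+1 < n)%N ->
  let a := g s x in let b := g s (state_up x) in
  dphi a b * bd_gen qp qm (g s) x + dphi b a * bd_gen qp qm (g s) (state_up x)
  <= edge_gen qp qm (fun y => phi (g s y) (g s (state_up y))) x.
Proof.
move=> s0 xn /=; rewrite /bd_gen /edge_gen state_upK//.
set a := g s x; set b := g s (state_up x).
set r := g s (state_up (state_up x)); set q := g s (state_down x).
have [a0 b0] : 0 < a /\ 0 < b by split; exact: g_gt0.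
have r0 : 0 < r by exact: g_gt0.
have q0 : 0 < q by exact: g_gt0.
have [hp hm] := hmono xn.
have ediag := phi_euler a0 b0.
(* Both end points jump up together, (a, b) becoming (b, r); in [Td] both jump down, giving (q,
   a). *)
have Tu : qp (state_up x) * (dphi a b * b + dphi b a * r) <=
    qp (state_up x) * phi b r.
  by rewrite ler_wpM2l ?(qp_ge0 hq)// phi_ge_differential.
have Td : qm x * (dphi a b * q + dphi b a * a) <=
    qm x * phi q (g s (state_up (state_down x))).
  have [x0|x0] := boolP (0 < x)%N.
    by rewrite state_downK// ler_wpM2l ?(qm_ge0 hq)// phi_ge_differential.
  by rewrite (qm_first hq x0) !mul0r.
(* Only the lower end point jumps, and the edge collapses to (b, b); in [Tm] the upper one jumps and
   the edge collapses to (a, a). Monotone rates make these excess rates nonnegative. *)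
have Tp : (qp x - qp (state_up x)) * (dphi a b * b + dphi b a * b) <= 0.
  rewrite mulr_ge0_le0 ?subr_ge0//.
  by have := phi_ge_differential a0 b0 b0 b0; rewrite phixx.
have Tm : (qm (state_up x) - qm x) * (dphi a b * a + dphi b a * a) <= 0.
  rewrite mulr_ge0_le0 ?subr_ge0//.
  by have := phi_ge_differential a0 b0 a0 a0; rewrite phixx.
rewrite ediag; lra.
Qed.

(** [H s x] plays the part of E_x[X_s]. *)
Variable H : R -> 'I_n -> R.
Hypothesis H_derive : forall s x, 0 <= s ->
  is_derive s 1 (H ^~ x) (bd_gen qp qm (H s) x).
Hypothesis H0_increment : forall x, (x.+1 < n)%N ->
  H 0 (state_up x) - H 0 x = 1.

Let w s x := H s (state_up x) - H s x.

Let w_derive s x : 0 <= s -> (x.+1 < n)%N ->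
  is_derive s 1 (w ^~ x) (edge_gen qp qm (w s) x).
Proof.
move=> s0 xn; rewrite edge_gen_increment//.
exact: is_deriveB (H_derive _ s0) (H_derive _ s0).
Qed.

(** The increments start at 1 on every edge, and the edge equation preserves nonnegativity. *)
Lemma increment_ge0 s x : 0 <= s -> 0 <= H s (state_up x) - H s x.
Proof.
move=> s0; apply: (edge_gen_ode_ge0 hq (v := w) s0) =>
  [r y /andP[r0 _]|r y _ yn|y].
- exact: w_derive.
- rewrite (_ : w ^~ y = cst 0); first exact: is_derive_cst.
  by apply/funext => r'; rewrite /w state_up_last// subrr.
- rewrite /w; have [yn|yn] := boolP (y.+1 < n)%N; first by rewrite H0_increment.
  by rewrite state_up_last// subrr.
Qed.

Lemma dissipation_evolution s t : 0 <= s -> 0 <= t ->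
  dissipation (g (s + t)) <=
  \sum_x p x * qp x * (w t x * phi (g s x) (g s (state_up x))).
Proof.
move=> s0 t0.
pose u r x := phi (g r x) (g r (state_up x)).
pose du r x := dphi (g r x) (g r (state_up x)) * bd_gen qp qm (g r) x +
  dphi (g r (state_up x)) (g r x) * bd_gen qp qm (g r) (state_up x).
(* The interpolation: weights run backward from time t, dissipation terms forward from time s. Its
   derivative pairs - G w with u and w with u' <= G u, and these cancel by reversibility. *)
pose f r := \sum_x p x * qp x * (w (-1 * r + t) x * u (1 * r + s) x).
have ft : f t = dissipation (g (s + t)).
  apply: eq_bigr => x _; rewrite mulN1r addNr mul1r (addrC t s).
  have [xn|xn] := boolP (x.+1 < n)%N; first by rewrite /w H0_increment// mul1r.
  by rewrite (qp_last hq xn) mulr0 !mul0r.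
have f0 : f 0 = \sum_x p x * qp x * (w t x * u s x).
  by apply: eq_bigr => x _; rewrite !mulr0 !add0r.
rewrite -ft -f0.
apply: (@le_of_derive_le0 _ f (fun r => \sum_x p x * qp x *
  (-1 * edge_gen qp qm (w (-1 * r + t)) x * u (1 * r + s) x +
   w (-1 * r + t) x * (1 * du (1 * r + s) x)))) => //.
  move=> r /andP[r0 rt]; apply: is_derive_fun_sum => x.
  have [xn|xn] := boolP (x.+1 < n)%N; last first.
    rewrite (qp_last hq xn) mulr0 mul0r.
    rewrite (_ : (fun _ => _) = cst 0); first exact: is_derive_cst.
    by apply/funext => z; rewrite mul0r.
  apply: is_derive_mull; apply: is_derive_fun_mul.
    apply: (@is_derive_affine_comp _ (w ^~ x)); apply: w_derive => //.
    by lra.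
  apply: (@is_derive_affine_comp _ (u ^~ x)).
  have h : 0 <= 1 * r + s by rewrite mul1r addr_ge0.
  by apply: is_derive_phi; [exact: g_gt0|exact: g_gt0|exact: g_derive..].
move=> r /andP[r0 rt].
have h : 0 <= 1 * r + s by rewrite mul1r addr_ge0.
have h' : 0 <= -1 * r + t by lra.
apply: (@le_trans _ _ (\sum_x p x * qp x *
  (w (-1 * r + t) x * edge_gen qp qm (u (1 * r + s)) x) -
   \sum_x p x * qp x *
  (u (1 * r + s) x * edge_gen qp qm (w (-1 * r + t)) x))); last first.
  by rewrite (edge_gen_reversible hq detailed_balance) subrr.
rewrite -sumrB; apply: ler_sum => x _.
rewrite -mulrBr ler_wpM2l// [1 * du _ _]mul1r mulN1r mulNr.
rewrite addrC [X in _ - X]mulrC lerB//.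
have [xn|xn] := boolP (x.+1 < n)%N.
  by apply: ler_wpM2l; [exact: increment_ge0|exact: phi_derive_le_edge_gen].
by rewrite /w state_up_last// subrr !mul0r.
Qed.

Lemma dissipation_contraction s t m : 0 <= s -> 0 <= t ->
  (forall x, (x.+1 < n)%N -> w t x <= m) ->
  dissipation (g (s + t)) <= m * dissipation (g s).
Proof.
move=> s0 t0 wm; apply: le_trans (dissipation_evolution s0 t0) _.
rewrite mulr_sumr; apply: ler_sum => x _.
have [xn|xn] := boolP (x.+1 < n)%N.
  by rewrite mulrCA ler_wpM2r ?wm// mulr_ge0// phi_ge0//; exact: g_gt0.
by rewrite (qp_last hq xn) mulr0 !mul0r mulr0.
Qed.

Lemma entropy_contraction t m : 0 <= t -> 0 <= m ->
  (forall x, (x.+1 < n)%N -> H t (state_up x) - H t x <= m) ->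
  entropy (g t) <= m * entropy (g 0).
Proof.
move=> t0 m0 wm; have [k k0 hk] := entropy_exp_decay.
have ent0 s : 0 <= s -> 0 <= entropy (g s).
  by move=> s0; apply: entropy_ge0 => [x|]; rewrite ?g_mass// ltW// g_gt0.
have mono s : 0 <= s ->
    m * entropy (g s) - entropy (g (1 * s + t)) <=
    m * entropy (g 0) - entropy (g t).
  move=> s0.
  have := @le_of_derive_le0 R
    (fun s => m * entropy (g s) - entropy (g (1 * s + t)))
    (fun s => m * - dissipation (g s) - 1 * - dissipation (g (1 * s + t)))
    0 s s0.
  rewrite mulr0 add0r; apply=> r /andP[r0 _].
    apply: is_deriveB; first exact: is_derive_mull (is_derive_entropy r0).
    apply: (@is_derive_affine_comp _ (fun s => entropy (g s))).
    by apply: is_derive_entropy; rewrite mul1r addr_ge0.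
  by have := dissipation_contraction r0 t0 wm; rewrite /= [1 * r]mul1r; lra.
rewrite leNgt; apply/negP => gap.
set X := m * entropy (g 0) - entropy (g t) in mono.
have X0 : X < 0 by rewrite subr_lt0.
(* If X < 0, the entropy stays above - X forever. Decay and e^v >= 1 + v give (1 + k s) (- X) <=
   Ent(g_0), which fails once k s (- X) equals Ent(g_0). *)
pose s := entropy (g 0) / (k * - X).
have s0 : 0 <= s by rewrite divr_ge0 ?ent0// mulr_ge0 ?ltW// oppr_gt0.
have st0 : 0 <= 1 * s + t by rewrite mul1r addr_ge0.
have h1 : - X <= entropy (g (1 * s + t)).
  have := mono s s0; have := mulr_ge0 m0 (ent0 s s0); lra.
have h2 := hk _ st0.
have h3 : (1 + k * s) * - X <= entropy (g 0).
  apply: le_trans h2; apply: ler_pM => //.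
  - by rewrite addr_ge0// mulr_ge0// ltW.
  - by rewrite ltW// oppr_gt0.
  - apply: le_trans (expR_ge1Dx _) _; rewrite ler_expR ler_wpM2l ?(ltW k0)//.
    by rewrite mul1r lerDl.
have : k * s * - X = entropy (g 0).
  by rewrite /s; field; rewrite (gt_eqF k0) (lt_eqF X0).
by move: h3; rewrite mulrDl mul1r; lra.
Qed.

End heat_flow.
End entropy_decay.

(** * Evolution of laws *)

Section law_evolution.
Context {R : realType} {n : nat}.
Variables qp qm : 'I_n -> R.
Hypothesis hq : bd_rates qp qm.
Implicit Types (s t m : R) (mu : 'rV[R]_n) (x y : 'I_n).

(** The constant 1 solves the backward equation, whose solutions are given by the semigroup. *)
Lemma bd_semigroup_rowsum t x : 0 <= t ->
  \sum_y semigroup (bd_mx qp qm) t x y = 1.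
Proof.
move=> t0; have h : forall s y, 0 <= s <= t ->
    is_derive s 1 ((fun _ _ => 1 : R) ^~ y) (\sum_z bd_mx qp qm y z * 1).
  move=> s y _; under eq_bigr do rewrite mulr1.
  by rewrite bd_mx_rowsum; exact: is_derive_cst.
have := linear_ode_sol t0 h x.
by under eq_bigr do rewrite mulr1.
Qed.

Lemma is_derive_semigroup_fun (f : 'I_n -> R) t x :
  is_derive t 1 (fun s => \sum_y semigroup (bd_mx qp qm) s x y * f y)
    (bd_gen qp qm (fun z => \sum_y semigroup (bd_mx qp qm) t z y * f y) x).
Proof.
have : is_derive t 1 (fun s => \sum_y semigroup (bd_mx qp qm) s x y * f y)
    (\sum_y f y * (bd_mx qp qm *m semigroup (bd_mx qp qm) t) x y).
  apply: is_derive_fun_sum => y; rewrite (_ : (fun _ => _) =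
    fun s => f y * semigroup (bd_mx qp qm) s x y); last first.
    by apply/funext => s; rewrite mulrC.
  exact/is_derive_mull/is_derive_semigroupl.
congr is_derive; rewrite bd_gen_sum.
under eq_bigr => y _ do rewrite mxE mulr_sumr.
rewrite exchange_big; apply: eq_bigr => z _ /=.
by rewrite mulr_sumr; apply: eq_bigr => y _; ring.
Qed.

Lemma increment_id x : (x.+1 < n)%N ->
  \sum_y semigroup (bd_mx qp qm) 0 (state_up x) y * state_val R y -
  \sum_y semigroup (bd_mx qp qm) 0 x y * state_val R y = 1.
Proof.
move=> xn; rewrite semigroup0.
under eq_bigr do rewrite mxE; under [X in _ - X]eq_bigr do rewrite mxE.
by rewrite !sum_delta /state_val val_state_up// -natrB// subSnn.
Qed.

Lemma mass_evolution mu t : 0 <= t ->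
  \sum_x (mu *m semigroup (bd_mx qp qm) t) 0 x = \sum_x mu 0 x.
Proof.
move=> t0; under eq_bigr => x _ do rewrite mxE.
rewrite exchange_big; apply: eq_bigr => y _ /=.
by rewrite -mulr_sumr bd_semigroup_rowsum// mulr1.
Qed.

(** * Densities with respect to the invariant law *)

Section density.
Variable pi : 'rV[R]_n.
Hypothesis hpi : invariant_law (bd_mx qp qm) pi.

Let pi_gt0 x : 0 < pi 0 x.
Proof. by apply: invariant_law_pos; [exact: hq|exact: hpi]. Qed.

Definition density mu x := mu 0 x / pi 0 x.

Lemma mul_density mu x : pi 0 x * density mu x = mu 0 x.
Proof. by rewrite mulrC divfK// gt_eqF. Qed.

Lemma rel_entropyE mu : rel_entropy mu pi = entropy (pi 0) (density mu).
Proof. by apply: eq_bigr => x _; rewrite [RHS]mulrA mul_density. Qed.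

(** Reversibility turns the forward equation of the law into the backward equation of its
    density. *)
Lemma is_derive_density mu s x :
  is_derive s 1 (fun s => density (mu *m semigroup (bd_mx qp qm) s) x)
    (bd_gen qp qm (density (mu *m semigroup (bd_mx qp qm) s)) x).
Proof.
have := is_derive_mull (pi 0 x)^-1 (is_derive_evolution (bd_mx qp qm) mu s x).
rewrite (_ : (fun r => _) =
  fun s => density (mu *m semigroup (bd_mx qp qm) s) x); last first.
  by apply/funext => r; rewrite /density mulrC.
congr is_derive; rewrite bd_gen_sum mxE mulr_sumr; apply: eq_bigr => y _.
have pin z : pi 0 z != 0 by rewrite gt_eqF.
have e : bd_mx qp qm x y = pi 0 y * bd_mx qp qm y x / pi 0 x.
  rewrite -(bd_mx_reversible hq (p := pi 0)) => [|z zn]; last first.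
    exact: invariant_law_detailed_balance.
  by rewrite mulrC mulKf.
by rewrite e /density; field; rewrite !pin.
Qed.

Lemma density_mass mu : \sum_x pi 0 x * density mu x = \sum_x mu 0 x.
Proof. by apply: eq_bigr => x _; exact: mul_density. Qed.

Lemma density_evolution_ge mu t : 0 <= t -> (forall x, 0 <= mu 0 x) ->
  exists2 c, 0 < c & forall x,
  c * density mu x <= density (mu *m semigroup (bd_mx qp qm) t) x.
Proof.
move=> t0 mu0.
have [c hc] := metzler_ode_ge (bd_mx_metzler hq).
exists (expR (- c * t)); first exact: expR_gt0.
move=> x; have := hc (fun s => density (mu *m semigroup (bd_mx qp qm) s)) t t0.
rewrite semigroup0 mulmx1; apply=> [s y _|y].
  by rewrite -bd_gen_sum; exact: is_derive_density.
by rewrite divr_ge0// ltW.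
Qed.

Hypothesis hmono : forall x : 'I_n, (x.+1 < n)%N ->
  qp (state_up x) <= qp x /\ qm x <= qm (state_up x).
Variables (t m : R).
Hypothesis t_ge0 : 0 <= t.
Hypothesis m_ge0 : 0 <= m.
Hypothesis m_ge_increment : forall x, (x.+1 < n)%N ->
  \sum_y semigroup (bd_mx qp qm) t (state_up x) y * state_val R y -
  \sum_y semigroup (bd_mx qp qm) t x y * state_val R y <= m.

Lemma rel_entropy_contraction_pos mu :
  (forall x, 0 < mu 0 x) -> \sum_x mu 0 x = 1 ->
  rel_entropy (mu *m semigroup (bd_mx qp qm) t) pi <= m * rel_entropy mu pi.
Proof.
move=> mu0 mu1; rewrite !rel_entropyE.
pose g s := density (mu *m semigroup (bd_mx qp qm) s).
have -> : density mu = g 0 by rewrite /g semigroup0 mulmx1.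
have [[_ pi1] _] := hpi.
apply: (@entropy_contraction _ _ qp qm hq (pi 0) pi_gt0 pi1
  (invariant_law_detailed_balance hpi) hmono g _ _ _
  (fun s x => \sum_y semigroup (bd_mx qp qm) s x y * state_val R y)) => //.
- by move=> s x s0; exact: is_derive_density.
- move=> s x s0.
  have [c c0 hc] := @density_evolution_ge mu s s0 (fun z => ltW (mu0 z)).
  by apply: lt_le_trans (hc x); rewrite mulr_gt0// divr_gt0.
- by move=> s s0; rewrite density_mass mass_evolution.
- by move=> s x s0; exact: is_derive_semigroup_fun.
- exact: increment_id.
Qed.

Lemma rel_entropy_contraction mu : is_law mu ->
  rel_entropy (mu *m semigroup (bd_mx qp qm) t) pi <= m * rel_entropy mu pi.
Proof.
move=> [mu0 mu1].
have [[pi0 pi1] inv] := hpi.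
set P := semigroup (bd_mx qp qm) t.
have dens0 x : 0 <= density mu x by rewrite divr_ge0.
have [c c0 hc] := @density_evolution_ge mu t t_ge0 mu0.
have densP0 x : 0 <= density (mu *m P) x.
  by apply: le_trans (hc x); rewrite mulr_ge0// ltW.
(* The positive case for (1 - e) mu + e pi, with explicit errors in place of continuity:
   superadditivity of x log x bounds the left entropy below, convexity bounds the right one
   above. *)
have main e : 0 < e -> e < 1 ->
    (1 - e) * rel_entropy (mu *m P) pi + (1 - e) * ln (1 - e) + e * ln e <=
    m * ((1 - e) * rel_entropy mu pi).
  move=> e0 e1; pose nu := (1 - e) *: mu + e *: pi.
  have nuE z x : density ((1 - e) *: z + e *: pi) x = (1 - e) * density z x + e.
    by rewrite /density !mxE; field; rewrite gt_eqF.
  have nuP : nu *m P = (1 - e) *: (mu *m P) + e *: pi.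
    by rewrite mulmxDl -!scalemxAl inv.
  have h : rel_entropy (nu *m P) pi <= m * rel_entropy nu pi.
    apply: rel_entropy_contraction_pos => [x|].
      by rewrite !mxE ltr_wpDl ?mulr_ge0 ?mulr_gt0 ?subr_ge0// ltW.
    under eq_bigr do rewrite !mxE.
    by rewrite big_split/= -!mulr_sumr mu1 pi1; ring.
  rewrite !rel_entropyE nuP in h *.
  apply: le_trans (_ : _ <=
      entropy (pi 0) (density ((1 - e) *: (mu *m P) + e *: pi))) _.
    have -> : (1 - e) * entropy (pi 0) (density (mu *m P)) +
        (1 - e) * ln (1 - e) + e * ln e = \sum_x pi 0 x * ((1 - e) * (density (mu *m P) x *
          ln (density (mu *m P) x)) + (1 - e) * ln (1 - e) * density (mu *m P) x
          + e * ln e).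
      under [RHS]eq_bigr => x _ do rewrite 2!mulrDr
        [pi 0 x * ((1 - e) * (_ * _))]mulrCA [pi 0 x * (_ * density _ _)]mulrCA.
      rewrite !big_split/= -!mulr_sumr density_mass mass_evolution// mu1 mulr1.
      by rewrite -mulr_suml pi1 mul1r.
    apply: ler_sum => x _; rewrite ler_wpM2l// nuE.
    apply: le_trans (xlnx_superadditive _ (ltW e0)); last first.
      by rewrite mulr_ge0// subr_ge0 ltW.
    rewrite lerD2r; move: (density _ x) (densP0 x) => f.
    rewrite le_eqVlt => /predU1P[<-|f0]; first by rewrite !(mul0r,mulr0) addr0.
    by rewrite (@lnM _ (1 - e)) ?posrE ?subr_gt0//; lra.
  apply: le_trans h _; rewrite ler_wpM2l// mulr_sumr; apply: ler_sum => x _.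
  rewrite nuE [leRHS]mulrCA ler_wpM2l//.
  (* [z] is the mean of f and 1 with weights 1 - e and e; the linear parts of the tangents at [z]
     cancel in this mean. *)
  set f := density mu x; set z := (1 - e) * f + e.
  have z0 : 0 < z by rewrite ltr_wpDl// mulr_ge0 ?dens0// subr_ge0 ltW.
  have h1 := xlnx_tangent (dens0 x) z0.
  have h2 := xlnx_tangent ler01 z0.
  rewrite ln1 mulr0 in h2.
  have h3 : (1 - e) * (z * ln z + (ln z + 1) * (f - z)) <= (1 - e) * (f * ln f).
    by rewrite ler_wpM2l// subr_ge0 ltW.
  have h4 : e * (z * ln z + (ln z + 1) * (1 - z)) <= 0.
    by rewrite pmulr_rle0.
  have h5 : (1 - e) * ((ln z + 1) * (f - z)) + e * ((ln z + 1) * (1 - z)) = 0.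
    by rewrite /z; ring.
  lra.
rewrite leNgt; apply/negP => gap.
set d := rel_entropy (mu *m P) pi - m * rel_entropy mu pi.
have d0 : 0 < d by rewrite subr_gt0.
(* With e = r^2, the bound log r >= 1 - 1/r keeps the total error below 2 r <= d / 2, while (1 -
   r^2) d is at least 3 d / 4. *)
pose r := Num.min 2^-1 (d / 4).
have r0 : 0 < r by rewrite lt_min; apply/andP; split; lra.
have r1 : r <= 2^-1 by rewrite ge_min lexx.
have r2 : r <= d / 4 by rewrite ge_min lexx orbT.
have rr0 : 0 < r ^+ 2 by rewrite exprn_gt0.
have rr : r ^+ 2 <= 4^-1 by nra.
have h1 := main (r ^+ 2) rr0 ltac:(lra).
have h2 : - r ^+ 2 <= (1 - r ^+ 2) * ln (1 - r ^+ 2).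
  have p0 : 0 < 1 - r ^+ 2 by lra.
  have := ge_ln_1subV p0; rewrite -(ler_pM2l p0) mulrBr mulr1 divff ?gt_eqF//.
  by lra.
have h3 : r ^+ 2 * 2 - r * 2 <= r ^+ 2 * ln (r ^+ 2).
  have := ge_ln_1subV r0; rewrite -(ler_pM2l rr0) mulrBr mulr1 => h.
  have e : r ^+ 2 / r = r by rewrite expr2 mulfK// gt_eqF.
  by rewrite e in h; rewrite lnXn// -mulr_natr mulrA; lra.
have h4 : (1 - r ^+ 2) * d <= r * 2 - r ^+ 2.
  by move: h1 h2 h3; rewrite /d; lra.
have h5 : 3 / 4 * d <= (1 - r ^+ 2) * d by rewrite ler_wpM2r ?(ltW d0)//; lra.
lra.
Qed.

End density.
End law_evolution.

(** * Expectations of the chain *)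

Lemma expectation_finite {R : realType} (d : measure_display)
    (T : measurableType d) (P : probability T R) (I : finType) (Y : T -> I)
    (f : I -> R) (q : I -> R) :
  (forall i, 0 <= f i) -> (forall i, measurable (Y @^-1` [set i])) ->
  (forall i, P (Y @^-1` [set i]) = (q i)%:E) ->
  ('E_P[fun w => f (Y w)] = (\sum_i q i * f i)%:E)%E.
Proof.
move=> f0 mY Pq; rewrite unlock.
have -> : (fun w => (f (Y w))%:E) =
    fun w => (\sum_i (f i)%:E * (\1_(Y @^-1` [set i]) w)%:E)%E.
  apply/funext => w; rewrite (bigD1 (Y w))//= big1.
    by rewrite adde0 indicE mem_set// mule1.
  move=> i iw; rewrite indicE memNset ?mule0//= => e.
  by rewrite e eqxx in iw.
rewrite ge0_integral_sum//.
- rewrite -sumEFin; apply: eq_bigr => i _.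
  rewrite ge0_integralZl_EFin//; last exact/measurable_EFinP/measurable_indic.
  by rewrite integral_indic// setIT [in RHS]mulrC EFinM -Pq.
- by move=> i; apply: measurable_funeM; exact/measurable_EFinP/measurable_indic.
- by move=> i w _; rewrite mule_ge0// lee_fin.
Qed.

Section chain_law.
Context {R : realType} {n : nat}.
Variables (A : 'M[R]_n) (d : measure_display) (T : measurableType d).
Variables (Pr : 'I_n -> probability T R) (X : R -> T -> 'I_n).
Hypothesis hX : markov_chain A Pr X.

(** The hypothesis gives the joint law at times 0 and t; its case k = 0 shows that X_0 = x almost
    surely under [Pr x]. *)
Lemma markov_chain_law (t : R) x y : 0 <= t ->
  Pr x (X t @^-1` [set y]) = (semigroup A t x y)%:E.
Proof.
move=> t0; have [mX fdd] := hX.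
have mt := mX t y t0; have m0 := mX 0 x (lexx 0).
have P0 : Pr x (X 0 @^-1` [set x]) = 1%:E.
  have := fdd 0%N (fun=> 0) (fun=> x) erefl (fun=> lexx 0).
  by rewrite big_ord0 bigcap_mkord big_ord_recl big_ord0 setIT.
have := fdd 1%N (fun i => if i == 0%N then 0 else t)
  (fun i => if i == 0%N then x else y) erefl.
rewrite big_ord1/= subr0 => <-; last by case.
rewrite bigcap_mkord !big_ord_recl big_ord0/= setIT.
rewrite (measureDI _ mt m0) setIC -[RHS]add0e; congr (_ + _)%E.
apply: (@subset_measure0 _ _ _ _ _ (~` (X 0 @^-1` [set x]))).
- exact: measurableD.
- exact: measurableC.
- by move=> w [].
- by apply: etrans (probability_setC (Pr x) m0) _; rewrite P0 subee.
Qed.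

Lemma expectation_state (t : R) x : 0 <= t ->
  ('E_(Pr x)[fun w => state_val R (X t w)] =
   (\sum_y semigroup A t x y * state_val R y)%:E)%E.
Proof.
move=> t0; have [mX _] := hX; apply: expectation_finite => [y|y|y].
- exact: ler0n.
- exact: mX.
- exact: markov_chain_law.
Qed.

(** Since n >= 2 there is at least one edge, so the maximum is a real number. *)
Lemma max_incrementE (t : R) : (2 <= n)%N -> 0 <= t ->
  exists2 m, max_increment Pr X t = m%:E & forall x : 'I_n, (x.+1 < n)%N ->
  \sum_y semigroup A t (state_up x) y * state_val R y -
  \sum_y semigroup A t x y * state_val R y <= m.
Proof.
move=> n2 t0.
have -> : max_increment Pr X t = (\big[maxe/-oo]_(x < n | (x.+1 < n)%N)
    (\sum_y semigroup A t (state_up x) y * state_val R y -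
     \sum_y semigroup A t x y * state_val R y)%:E)%E.
  by apply: eq_bigr => x _; rewrite !expectation_state.
set M := (\big[_/_]_(_ < _ | _) _)%E.
have le_M (x : 'I_n) : (x.+1 < n)%N ->
    ((\sum_y semigroup A t (state_up x) y * state_val R y -
     \sum_y semigroup A t x y * state_val R y)%:E <= M)%E.
  by move=> xn; exact: le_bigmax_cond.
have M_fin : M \is a fin_num.
  rewrite fin_numElt; apply/andP; split.
    apply: lt_le_trans (le_M (Ordinal (ltnW n2)) n2); exact: ltNyr.
  by apply: bigmax_lt => // x _; exact: ltry.
exists (fine M); first by rewrite fineK.
by move=> x /le_M; rewrite -[X in (_ <= X)%E -> _]fineK// lee_fin.
Qed.

End chain_law.

Theorem corollary2 (R : realType) (n : nat) (hn : (2 <= n)%N)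
  (qp qm : 'I_n -> R) (hq : bd_rates qp qm)
  (hmono : forall x : 'I_n, (x.+1 < n)%N ->
     qp (state_up x) <= qp x /\ qm x <= qm (state_up x))
  (d : measure_display) (T : measurableType d) (Pr : 'I_n -> probability T R)
  (X : R -> T -> 'I_n) (hX : markov_chain (bd_mx qp qm) Pr X)
  (pi : 'rV[R]_n) (hpi : invariant_law (bd_mx qp qm) pi)
  (mu : 'rV[R]_n) (hmu : is_law mu) (t : R) (ht : 0 <= t) :
  ((rel_entropy (mu *m semigroup (bd_mx qp qm) t) pi)%:E
   <= max_increment Pr X t * (rel_entropy mu pi)%:E)%E.
Proof.
have [m -> hm] := max_incrementE hX hn ht.
rewrite -EFinM lee_fin; apply: rel_entropy_contraction => //.
(* The maximum is nonnegative because it dominates the increment over the first edge. *)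
apply: le_trans (hm (Ordinal (ltnW hn)) hn).
apply: (@increment_ge0 _ _ _ _ hq
  (fun s x => \sum_y semigroup (bd_mx qp qm) s x y * state_val R y)) => //.
- by move=> s x s0; exact: is_derive_semigroup_fun.
- exact: increment_id.
Qed.
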